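(* Let $G$ be a cubic (i.e. $3$-regular) graph on $n$ vertices, and let $s=\lceil (n+3)/4\rceil$. Then $\operatorname{tvs}(G)=s$. Moreover, $G$ has a vertex irregular total $s$-labeling in which every edge receives label $1$ or $s$.
   Context: All graphs are finite and simple, and need not be connected. For a positive integer $k$, a total $k$-labeling of a graph $G$ is a mapping $\lambda:V(G)\cup E(G)\to\{1,\ldots,k\}$. The weight of a vertex $v$ under $\lambda$ is $\operatorname{wt}_\lambda(v)=\lambda(v)+\sum_{e\ni v}\lambda(e)$, the sum being over the edges $e$ of $G$ incident with $v$. The labeling $\lambda$ is vertex irregular if $\operatorname{wt}_\lambda(u)\ne\operatorname{wt}_\lambda(v)$ for any two distinct vertices $u,v\in V(G)$. The total vertex irregularity strength $\operatorname{tvs}(G)$ is the smallest positive integer $k$ for which $G$ has a vertex irregular total $k$-labeling. *)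

(* Defs.v *)
From mathcomp Require Import all_boot all_order all_algebra.
From mathcomp Require Import boolp.

Set Implicit Arguments.
Unset Strict Implicit.
Unset Printing Implicit Defensive.

Record sgraph := SGraph {
  vertex :> finType;
  adj : rel vertex;
  adj_sym : symmetric adj;
  adj_irrefl : irreflexive adj }.

Definition edges (G : sgraph) : {set {set G}} :=
  [set [set p.1; p.2] | p : G * G & adj p.1 p.2].

Definition edge (G : sgraph) : finType := {e : {set G} | e \in edges G}.

Definition cubic (G : sgraph) : Prop :=
  forall v : G, #|[set w : G | adj v w]| = 3.

(* The sum type [G + edge G] is the disjoint union of V(G) and E(G). *)
Definition total_labeling (G : sgraph) (k : nat)
    (lam : G + edge G -> nat) : Prop :=
  forall x : G + edge G, 1 <= lam x <= k.

Definition weight (G : sgraph) (lam : G + edge G -> nat) (v : G) : nat :=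
  lam (inl v) + \sum_(e : edge G | v \in val e) lam (inr e).

Definition vertex_irregular (G : sgraph) (lam : G + edge G -> nat) : Prop :=
  forall u v : G, u <> v -> weight lam u <> weight lam v.

Definition has_irregular_labeling (G : sgraph) (k : nat) : Prop :=
  exists lam : G + edge G -> nat, total_labeling k lam /\ vertex_irregular lam.

Lemma ex_irregular_labeling (G : sgraph) :
  exists k, (0 < k) && `[< has_irregular_labeling G k >].
Proof.
pose d (v : G) := #|[pred e : edge G | v \in val e]|.
have d_le v : d v <= #|edge G| by apply: max_card.
exists (#|edge G| + #|G|).+1; apply/andP; split=> //; apply/asboolP.
exists (fun x => match x with
  | inl v => (#|edge G| - d v + enum_rank v).+1
  | inr _ => 1 end); split.
  case=> [v|e] //=; rewrite ltnS leq_add ?leq_subr //.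
  exact/ltnW/ltn_ord.
have wE v : (#|edge G| - d v + enum_rank v).+1 +
    \sum_(e : edge G | v \in val e) 1 = (#|edge G| + enum_rank v).+1.
  by rewrite sum1_card addSn addnAC subnK.
move=> u v neq_uv; rewrite /weight !wE => -[/addnI /val_inj /enum_rank_inj].
exact: neq_uv.
Qed.

Definition tvs (G : sgraph) : nat := ex_minn (ex_irregular_labeling G).

(* Main.v *)
Require Import Defs.
From mathcomp Require Import all_boot all_order all_algebra.
From mathcomp Require Import boolp zify.

Set Implicit Arguments.
Unset Strict Implicit.
Unset Printing Implicit Defensive.

(* Let F be a set of edges of G and n_i the number of vertices of F-degree i.
   Giving label s to the edges of F and 1 to the others, a vertex of F-degree i
   can realise the s weights from 4 + i(s-1) to 4 + (i+1)(s-1), and distinct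
   weights can be chosen as soon as the n_i are nearly equal ([balanced]).  Take
   F minimising the sum of the n_i^2.  Flipping the status of one edge, of two
   similar edges sharing a vertex, or of two such stars between disjoint degree
   classes changes (n_0, n_1, n_2, n_3) by a vector depending only on the degrees
   involved, so no configuration whose flip would lower the sum occurs in F.
   Double counting the edges between degree classes, these absences force F to be
   balanced, up to three exceptional vectors that are treated apart.  Replacing F
   by its complement maps n_i to n_(3-i). *)

(** * Degree classes and edge flips *)

Section Flips.
Variable G : sgraph.
Implicit Types (F : {set {set G}}) (b c : bool) (u v w x y : G) (L : seq G).

Definition link F b : rel G := fun u v => adj u v && (([set u; v] \in F) == b).

Definition deg F v := #|[set u | link F true v u]|.

Definition lev F i := #|[set v | deg F v == i]|.

(* Number of ordered pairs, so that each edge counts twice when [i = j]. *)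
Definition joint F b i j :=
  \sum_(v | deg F v == i) #|[set u | link F b v u && (deg F u == j)]|.

Lemma link_sym F b : symmetric (link F b).
Proof. by move=> u v; rewrite /link adj_sym setUC. Qed.

Lemma link_irrefl F b : irreflexive (link F b).
Proof. by move=> v; rewrite /link adj_irrefl. Qed.

Lemma joint_sym F b i j : joint F b i j = joint F b j i.
Proof.
have ex (P Q : pred G) :
    \sum_(v | P v) #|[set u | link F b v u && Q u]|
    = \sum_v \sum_u [&& link F b v u, P v & Q u].
  rewrite big_mkcond; apply: eq_bigr => v _; case: (P v) => /=.
    rewrite -sum1dep_card big_mkcond; apply: eq_bigr => u _.
    by case: (_ && _).
  by rewrite big1 // => u _; rewrite andbF.
rewrite /joint !ex exchange_big; apply: eq_bigr => u _; apply: eq_bigr => v _.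
by rewrite link_sym [X in _ && X]andbC.
Qed.

(** [b] is the status before the flip, so flipping edges of [F] lowers the degree. *)
Definition shift b l i := if b then i - l else i + l.

Lemma deg_shift F F' b x (C : {set G}) :
    {in C, forall u, link F b x u} ->
    (forall u, link F' true x u = link F true x u (+) (u \in C)) ->
  deg F' x = shift b #|C| (deg F x).
Proof.
move=> CF F'E; rewrite /deg /shift; case: b CF => CF.
  rewrite -cardsDS; last by apply/subsetP => u uC; rewrite inE CF.
  apply: eq_card => u; rewrite !inE F'E.
  by case: (boolP (u \in C)) => [/CF ->|]; rewrite ?addbF.
rewrite -cardsUI [X in _ = _ + X](_ : _ = 0) ?addn0.
  apply: eq_card => u; rewrite !inE F'E.
  case: (boolP (u \in C)) => [/CF|]; rewrite ?addbF ?orbF // orbT addbT.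
  by rewrite /link => /andP[-> /eqP->].
apply/eqP; rewrite cards_eq0; apply/eqP/setP => u; rewrite !inE.
by apply/negP => /andP[] /[swap] /CF; rewrite /link => /andP[_ /eqP ->] /andP[].
Qed.

Definition star F b w L := uniq (w :: L) && all (link F b w) L.

(** The last clause leaves edges away from the centre intact, so that a second, disjoint star can be
    flipped afterwards. *)
Lemma flip_star F b w L : star F b w L -> exists F',
  [/\ deg F' w = shift b (size L) (deg F w),
      {in L, forall x, deg F' x = shift b 1 (deg F x)},
      forall x, x \notin w :: L -> deg F' x = deg F x &
      forall c x y, x != w -> y != w -> link F' c x y = link F c x y].
Proof.
case/andP => /= /andP[wL uL] /allP LF.
pose F' := [set e | (e \in F) (+) (e \in [seq [set w; x] | x <- L])].
have offw c x y : x != w -> y != w -> link F' c x y = link F c x y.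
  move=> xw yw; rewrite /link inE [X in _ (+) X](_ : _ = false) ?addbF //.
  apply/negP => /mapP[z _ /setP/(_ w)].
  by rewrite !inE eqxx eq_sym (negPf xw) eq_sym (negPf yw).
have memL y : ([set w; y] \in [seq [set w; x] | x <- L]) = (y \in L).
  apply/mapP/idP => [[z zL /setP E]|]; last by exists y.
  have := E z; have := E y; rewrite !inE !eqxx !orbT.
  case: (eqVneq z w) wL => [<-|_]; first by rewrite zL.
  by move=> _ _ /eqP <-.
have onw u : link F' true w u = link F true w u (+) (u \in [set x in L]).
  rewrite /link !inE memL !eqb_id.
  case: (boolP (u \in L)) => [/LF/andP[->]|]; last by rewrite !addbF.
  by rewrite !addbT.
exists F'; split => //.
- rewrite (deg_shift (b := b) _ onw) => [|u]; last by rewrite inE => /LF.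
  by rewrite cardsE (card_uniqP uL).
- move=> x xL; rewrite (@deg_shift F F' b x [set w]) ?cards1 // => u.
    by rewrite inE => /eqP->; rewrite link_sym LF.
  rewrite inE; case: eqP => [->|/eqP uw].
    by rewrite link_sym onw inE xL link_sym.
  by rewrite addbF offw //; apply: contraNneq wL => <-.
- move=> x; rewrite inE negb_or => /andP[xw xL].
  rewrite /deg; apply: eq_card => u; rewrite !inE.
  case: (eqVneq u w) => [->|uw]; last exact: offw.
  by rewrite link_sym onw inE (negPf xL) addbF link_sym.
Qed.

Definition mult k (s : seq nat) := size (filter (pred1 k) s).

Lemma lev_change F F' (W : seq G) k :
    uniq W -> (forall x, x \notin W -> deg F' x = deg F x) ->
  lev F' k + mult k (map (deg F) W) = lev F k + mult k (map (deg F') W).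
Proof.
move=> uW F'E.
have levE H : lev H k =
    mult k (map (deg H) W) + \sum_(x | x \notin W) (deg H x == k).
  rewrite /mult size_filter count_map -sum1_count big_mkcond /=.
  rewrite (big_uniq _ uW) /lev -sum1dep_card big_mkcond (bigID (mem W)) /=.
  by congr addn; apply: eq_bigr => x _; case: eqP.
rewrite !levE; under eq_bigr do rewrite F'E //.
by rewrite addnC addnA [in RHS]addnAC.
Qed.


Definition energy F := sumn [seq lev F k ^ 2 | k <- iota 0 4].

Definition optimal F := forall F', energy F <= energy F'.

(* Linear form of: replacing degrees [ds] by [ds'] does not lower the sum of the
   [n k ^ 2], the quadratic terms cancelling out. *)
Definition no_gain (n : nat -> nat) (ds ds' : seq nat) :=
  sumn [seq 2 * mult k ds * (n k + mult k ds') | k <- iota 0 4] <=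
  sumn [seq 2 * mult k ds' * n k +
    (mult k ds' * mult k ds' + mult k ds * mult k ds) | k <- iota 0 4].

(** Only the level counts matter, since they determine the energy; the additive form avoids
    truncated subtraction. *)
Definition moves F ds ds' :=
  exists F', forall k, lev F' k + mult k ds = lev F k + mult k ds'.

Lemma optimal_no_gain F ds ds' :
  optimal F -> moves F ds ds' -> no_gain (lev F) ds ds'.
Proof.
move=> optF [F' H]; have := optF F'.
rewrite /energy /no_gain /=.
(* Both sides equal [(lev F k + mult k ds') ^ 2 + mult k ds ^ 2]. *)
have sq k : lev F' k ^ 2 + 2 * mult k ds * (lev F k + mult k ds') =
    lev F k ^ 2 + (2 * mult k ds' * lev F k +
      (mult k ds' * mult k ds' + mult k ds * mult k ds)).
  move: (H k) => Hk; rewrite -Hk -!mulnn.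
  have : (lev F' k + mult k ds) * (lev F' k + mult k ds) =
    (lev F k + mult k ds') * (lev F k + mult k ds') by rewrite Hk.
  lia.
by move: (sq 0) (sq 1) (sq 2) (sq 3); lia.
Qed.

(* [(b, i, l, j)]: flip [l] edges, present in [F] iff [b], from a centre of
   degree [i] to leaves of degree [j]. *)
Definition star_type := (bool * nat * nat * nat)%type.

Definition before (t : star_type) := let: (b, i, l, j) := t in i :: nseq l j.

Definition after (t : star_type) :=
  let: (b, i, l, j) := t in shift b l i :: nseq l (shift b 1 j).

Definition star_at F (t : star_type) w L :=
  let: (b, i, l, j) := t in star F b w L /\ map (deg F) (w :: L) = before t.

(* By pigeonhole, some vertex of degree [i] then has [l] suitable neighbours. *)
Definition crowded F (t : star_type) :=
  let: (b, i, l, j) := t in l.-1 * lev F i < joint F b i j.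

Lemma star_at_after F F' t w L :
    let: (b, _, _, _) := t in
    star_at F t w L -> deg F' w = shift b (size L) (deg F w) ->
    {in L, forall x, deg F' x = shift b 1 (deg F x)} ->
  map (deg F') (w :: L) = after t.
Proof.
case: t => [[[b i] l] j] [_ /= [<- Lj]] -> F'L; congr (_ :: _).
  by rewrite -(size_map (deg F)) Lj size_nseq.
have -> : map (deg F') L = map (shift b 1 \o deg F) L by apply/eq_in_map.
by rewrite map_comp Lj map_nseq.
Qed.

Lemma moves_star F t w L : star_at F t w L -> moves F (before t) (after t).
Proof.
move=> wL; have := @star_at_after F _ t w L.
case: t wL => [[[b i] l] j] wL; have [/[dup] /andP[uL _] bL beforeE] := wL.
have [F' [F'w F'L F'off _]] := flip_star bL.
move=> /(_ F' wL F'w F'L) afterE; exists F' => k.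
by rewrite -beforeE -afterE; apply: lev_change.
Qed.

(** By disjointness, the first flip changes no degree and no edge of the second star. *)
Lemma moves_star2 F t t' w L w' L' :
    star_at F t w L -> star_at F t' w' L' -> uniq ((w :: L) ++ (w' :: L')) ->
  moves F (before t ++ before t') (after t ++ after t').
Proof.
move=> wL wL'; rewrite cat_uniq => /and3P[uL /hasPn dis uL'].
have := @star_at_after F _ t w L.
case: t wL => [[[b i] l] j] wL; have [bL beforeE] := wL.
have [F1 [F1w F1L F1off F1link]] := flip_star bL.
move=> /(_ F1 wL F1w F1L) afterE.
have F1L' : {in w' :: L', deg F1 =1 deg F} by move=> x /dis; apply: F1off.
have wL1 : star_at F1 t' w' L'.
  case: t' wL' => [[[c i'] l'] j'] [/andP[_ /allP cL'] E]; split.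
    rewrite /star uL'; apply/allP => x xL'; rewrite F1link ?cL' //.
      by have := dis w' (mem_head _ _); rewrite inE negb_or => /andP[].
    have /dis : x \in w' :: L' by rewrite inE xL' orbT.
    by rewrite inE negb_or => /andP[].
  by rewrite -E; apply/eq_in_map.
have := @star_at_after F1 _ t' w' L'.
case: t' wL' wL1 => [[[c i'] l'] j'] [_ beforeE'] wL1; have [cL' _] := wL1.
have [F2 [F2w F2L F2off _]] := flip_star cL'.
move=> /(_ F2 wL1 F2w F2L) afterE'; exists F2 => k.
rewrite -beforeE -beforeE' -afterE -afterE' -map_cat.
have -> : map (deg F1) (w :: L) = map (deg F2) (w :: L).
  apply/eq_in_map => x xL; rewrite F2off //.
  by apply: contraL xL => /dis.
rewrite -map_cat; apply: lev_change.
  by rewrite cat_uniq uL uL' andbT; apply/hasPn.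
by move=> x; rewrite mem_cat negb_or => /andP[xL xL']; rewrite F2off ?F1off.
Qed.

(** A vertex of [X] accounts for at most 3 pairs. If every other vertex of degree [i] accounted for
    at most [l.-1], there would be too few pairs. *)
Lemma crowded_star F b i l j (X : {set G}) : cubic G ->
    l.-1 * lev F i + 3 * #|X| < joint F b i j ->
  exists w L, w \notin X /\ star_at F (b, i, l, j) w L.
Proof.
move=> cub; pose N w := [set u | link F b w u && (deg F u == j)].
have [/existsP[w /and3P[wX /eqP wi lN]] _|none] :=
    boolP [exists w, [&& w \notin X, deg F w == i & l.-1 < #|N w|]].
  have lN' : l <= size (enum (N w)) by rewrite -cardE; lia.
  have LN x : x \in take l (enum (N w)) -> link F b w x /\ deg F x = j.
    by move/mem_take; rewrite mem_enum inE => /andP[-> /eqP].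
  exists w, (take l (enum (N w))); split=> //; split.
    rewrite /star /= take_uniq ?enum_uniq // andbT; apply/andP; split.
      by apply/negP => /LN[] /andP[]; rewrite adj_irrefl.
    by apply/allP => x /LN[].
  rewrite /= wi; congr (_ :: _); apply: (@eq_from_nth _ 0).
    by rewrite size_map size_nseq size_takel.
  move=> k; rewrite size_map => kl; rewrite nth_nseq (nth_map w) //.
  have [_ ->] := LN _ (mem_nth w kl).
  by move: kl; rewrite size_takel // => ->.
rewrite ltnNge => /negP[]; rewrite /joint (bigID (mem X)) /= addnC leq_add //.
  rewrite /lev -sum1dep_card big_distrr /= big_mkcondr /=.
  apply: leq_sum => w wi; case: ifP => // wX; rewrite muln1 leqNgt.
  by apply: contraNN none => lN; apply/existsP; exists w; rewrite wX wi.
rewrite mulnC -sum_nat_const big_mkcondl [leqRHS]big_mkcond [leqLHS]big_mkcond.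
apply: leq_sum => w _; case: ifP => // wX; case: ifP => // _.
rewrite -(cub w) subset_leq_card //; apply/subsetP => u.
by rewrite !inE /link => /andP[/andP[]].
Qed.

End Flips.

(** * Double counting by degree class *)

(** Handshake argument: with the vertices ranked, each related pair is counted once in each
    order. *)
Lemma even_sym_rel (T : finType) (r : rel T) :
  symmetric r -> irreflexive r -> ~~ odd (\sum_v #|[set u | r v u]|).
Proof.
move=> sr ir; pose lt (v u : T) := enum_rank v < enum_rank u.
have -> : \sum_v #|[set u | r v u]| =
    (\sum_v \sum_u (r v u && lt v u)).*2.
  rewrite -addnn [X in _ = _ + X]exchange_big -big_split; apply: eq_bigr => v _.
  rewrite -sum1dep_card big_mkcond -big_split; apply: eq_bigr => u _ /=.
  rewrite (sr u v) /lt; case: ltngtP => [_|_|/val_inj/enum_rank_inj->];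
    by rewrite ?andbT ?andbF ?ir //; case: (r v u).
by rewrite odd_double.
Qed.

Section Levels.
Variable G : sgraph.
Hypothesis cub : cubic G.
Implicit Types (F : {set {set G}}) (b : bool) (v : G).

Lemma card_link F b v :
  #|[set u | link F b v u]| = if b then deg F v else 3 - deg F v.
Proof.
case: b => //; rewrite -(cub v) /deg.
rewrite -[in RHS](cardsID [set u | link F true v u] [set u | adj v u]).
have /setIidPr -> : [set u | link F true v u] \subset [set u | adj v u].
  by apply/subsetP => u; rewrite !inE => /andP[].
rewrite addKn; apply: eq_card => u.
by rewrite !inE /link; case: adj => //=; case: (_ \in F).
Qed.

Lemma deg_le3 F v : deg F v <= 3.
Proof.
rewrite -(cub v) /deg subset_leq_card //.
by apply/subsetP => u; rewrite !inE => /andP[].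
Qed.

Lemma card_by_deg F (A : pred G) :
  #|[set u | A u]| = \sum_(j < 4) #|[set u | A u && (deg F u == j)]|.
Proof.
under eq_bigr do rewrite -sum1dep_card big_mkcondr.
rewrite exchange_big -sum1dep_card; apply: eq_bigr => u _ /=.
rewrite !big_ord_recl big_ord0 /=.
by case: (deg F u) (deg_le3 F u) => [|[|[|[|]]]].
Qed.

Lemma lev_total F : lev F 0 + lev F 1 + lev F 2 + lev F 3 = #|G|.
Proof.
rewrite -cardsT (card_by_deg F xpredT) !big_ord_recl big_ord0 /=.
by rewrite addn0 !addnA.
Qed.

Lemma joint_total F b i :
  joint F b i 0 + joint F b i 1 + joint F b i 2 + joint F b i 3 =
  (if b then i else 3 - i) * lev F i.
Proof.
rewrite /joint -!big_split /= mulnC /lev -sum_nat_cond_const.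
apply: eq_bigr => v /eqP <-; rewrite -card_link [RHS](card_by_deg F).
by rewrite !big_ord_recl big_ord0 /= addn0 !addnA.
Qed.

Lemma joint_true0 F i : joint F true i 0 = 0.
Proof.
apply: big1 => v _; apply/eqP; rewrite cards_eq0; apply/eqP/setP => u.
rewrite !inE link_sym; apply/negP => /andP[uv]; rewrite /deg cards_eq0.
by move=> /eqP/setP/(_ v); rewrite !inE uv.
Qed.

Lemma joint_false3 F i : joint F false i 3 = 0.
Proof.
apply: big1 => v _; apply/eqP; rewrite cards_eq0; apply/eqP/setP => u.
rewrite !inE link_sym; apply/negP => /andP[uv] /eqP u3.
have /eqP := card_link F false u; rewrite u3 cards_eq0 => /eqP/setP/(_ v).
by rewrite !inE uv.
Qed.

Lemma even_lev_odd F : ~~ odd (lev F 1 + lev F 3).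
Proof.
have := even_sym_rel (link_sym F true) (link_irrefl F true).
have -> : \sum_v #|[set u | link F true v u]| =
    lev F 1 + 2 * lev F 2 + 3 * lev F 3.
  rewrite /lev -!sum1dep_card !big_distrr /=.
  rewrite !(big_mkcond (fun v => deg F v == _)).
  rewrite -!big_split; apply: eq_bigr => v _ /=; rewrite -/(deg F v).
  by case: (deg F v) (deg_le3 F v) => [|[|[|[|]]]].
lia.
Qed.

Lemma even_order : ~~ odd #|G|.
Proof.
have := even_sym_rel (@adj_sym G) (@adj_irrefl G).
by under eq_bigr do rewrite cub; rewrite sum_nat_const oddM andbT.
Qed.

Lemma deg_setC F v : deg (~: F) v = 3 - deg F v.
Proof.
rewrite -(card_link F false) /deg; apply: eq_card => u; rewrite !inE /link inE.
by case: (_ \in F).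
Qed.

Lemma lev_setC F i : i <= 3 -> lev (~: F) i = lev F (3 - i).
Proof.
move=> i3; apply: eq_card => v; rewrite !inE deg_setC.
by have := deg_le3 F v; lia.
Qed.

(** Complementation is an involution that reverses the levels, hence preserves the energy. *)
Lemma optimal_setC F : optimal F -> optimal (~: F).
Proof.
move=> optF F'; have := optF (~: F'); rewrite /energy /= !lev_setC //.
rewrite subn0 subnn -[3 - 1]/2 -[3 - 2]/1; lia.
Qed.

Lemma optimal_exists : exists F, @optimal G F.
Proof.
exists [arg min_(F < set0) @energy G F]; case: arg_minnP => // F _ minF F'.
exact: minF.
Qed.

End Levels.

(** * Flips excluded by optimality *)

Section Moves.
Variable G : sgraph.
Hypothesis cub : cubic G.
Implicit Types (F : {set {set G}}) (t : star_type).

Lemma star_exists F t : crowded F t -> exists w L, star_at F t w L.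
Proof.
case: t => [[[b i] l] j] big.
have [w [L [_ wL]]] : exists w L, w \notin set0 /\ star_at F (b, i, l, j) w L.
  by apply: crowded_star; rewrite // cards0 muln0 addn0.
by exists w, L.
Qed.

Lemma crowded_moves F t : crowded F t -> moves F (before t) (after t).
Proof. by move=> /star_exists[w [L]]; apply: moves_star. Qed.

Lemma star_at_before F t w L x :
  star_at F t w L -> x \in w :: L -> deg F x \in before t.
Proof. by case: t => [[[b i] l] j] [_ <-] /(map_f (deg F)). Qed.

Lemma star_at_uniq F t w L : star_at F t w L -> uniq (w :: L).
Proof. by case: t => [[[b i] l] j] [/andP[]]. Qed.

(** Stars using disjoint sets of degrees cannot share a vertex. *)
Lemma crowded_moves2 F t t' : ~~ has (mem (before t)) (before t') ->
    crowded F t -> crowded F t' ->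
  moves F (before t ++ before t') (after t ++ after t').
Proof.
move=> dis tF tF'.
have [w [L wL]] := star_exists tF; have [w' [L' wL']] := star_exists tF'.
apply: (moves_star2 wL wL').
rewrite cat_uniq (star_at_uniq wL) (star_at_uniq wL') andbT.
apply: contraNN dis => /hasP[x xL' xL]; apply/hasP; exists (deg F x).
  exact: star_at_before wL' xL'.
exact: star_at_before wL xL.
Qed.

(** For a concrete star both alternatives are linear in [lev] and [joint], hence usable by [lia]. *)
Lemma single_cut F t : optimal F ->
  ~~ crowded F t \/ no_gain (lev F) (before t) (after t).
Proof.
move=> optF; have [tF|] := boolP (crowded F t); [right|by left].
exact: optimal_no_gain (crowded_moves tF).
Qed.

Lemma double_cut F t t' : optimal F -> ~~ has (mem (before t)) (before t') ->
  [\/ ~~ crowded F t, ~~ crowded F t'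
    | no_gain (lev F) (before t ++ before t') (after t ++ after t')].
Proof.
move=> optF dis; have [tF|] := boolP (crowded F t); last by constructor 1.
have [tF'|] := boolP (crowded F t'); last by constructor 2.
constructor 3; exact: optimal_no_gain (crowded_moves2 dis tF tF').
Qed.

Definition add i l j : star_type := (false, i, l, j).
Definition del i l j : star_type := (true, i, l, j).

End Moves.

(** * Linear bounds on the levels *)

(** Orienting [joint] by symmetry leaves one unknown per unordered pair of classes. *)
Ltac tidy := rewrite /no_gain /mult /= ?(joint_sym _ _ 1 0)
  ?(joint_sym _ _ 2 0) ?(joint_sym _ _ 2 1) ?(joint_sym _ _ 3 1)
  ?(joint_sym _ _ 3 2).

(* Case analysis on which of the stars [ts] are crowded: each is either
   absent (an upper bound on [joint]) or yields a linear inequality between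
   levels.  The lists below were found by computer; their order keeps the search
   small. *)
Ltac search cub optF ts :=
  first [ lia | lazymatch ts with
  | [:: ?t] :: ?ts' =>
    case: (single_cut cub t optF); tidy => ?; search cub optF ts'
  | [:: ?t; ?u] :: ?ts' =>
    case: (@double_cut _ cub _ t u optF isT); tidy => ?; search cub optF ts'
  end ].

(** The linear relations and the parity that hold for every [F], optimal or not. *)
Ltac counts cub F :=
  move: (joint_total cub F false 0) (joint_total cub F false 1)
    (joint_total cub F false 2) (joint_total cub F true 1)
    (joint_total cub F true 2) (joint_total cub F true 3)
    (even_lev_odd cub F);
  rewrite !joint_true0 // !(joint_false3 cub) //; tidy => ? ? ? ? ? ? ?.

Section Bounds.
Variable G : sgraph.
Hypothesis cub : cubic G.
Implicit Types F : {set {set G}}.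

(** The order [N] of a cubic graph is even, so [N + 3 <= 4 * s <= N + 6] leaves just these two
    cases. *)
Definition order_bound F s :=
  let N := lev F 0 + lev F 1 + lev F 2 + lev F 3 in
  N + 4 = 4 * s \/ N + 6 = 4 * s.

Lemma order_bound_setC F s : order_bound F s -> order_bound (~: F) s.
Proof.
rewrite /order_bound !lev_setC // subn0 subnn -[3 - 1]/2 -[3 - 2]/1; lia.
Qed.

Lemma lev0_le F s : optimal F -> order_bound F s -> lev F 0 <= s.
Proof.
move=> optF ordF; case: leqP => // ?; exfalso; counts cub F.
case: ordF => ?; search cub optF
  [:: [:: add 0 1 1]; [:: add 2 1 2]; [:: add 0 1 0]; [:: add 0 1 2];
    [:: add 0 2 1]; [:: add 1 1 2]; [:: add 0 2 0]; [:: add 1 2 1];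
    [:: add 0 1 0; add 1 2 1]; [:: del 3 1 3]].
Qed.

Lemma lev3_le F s : optimal F -> order_bound F s -> lev F 3 <= s.
Proof.
move=> optF ordF; rewrite -(lev_setC cub F (i := 0)) //.
exact: lev0_le (optimal_setC cub optF) (order_bound_setC ordF).
Qed.

Lemma lev01_lt F s : optimal F -> order_bound F s -> lev F 0 + lev F 1 < 2 * s.
Proof.
move=> optF ordF; case: ltnP => // ?; exfalso; counts cub F.
have := lev0_le optF ordF; have := lev3_le optF ordF => *.
case: ordF => ?; search cub optF
  [:: [:: add 0 1 1]; [:: add 1 1 2]; [:: add 1 2 1];
    [:: add 0 1 2; add 1 1 1]; [:: add 2 1 2]; [:: add 2 1 2; add 0 2 1];
    [:: add 0 1 2]; [:: add 0 1 0; add 1 2 1]].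
Qed.

Lemma lev23_lt F s : optimal F -> order_bound F s -> lev F 2 + lev F 3 < 2 * s.
Proof.
move=> optF ordF.
have := lev01_lt (optimal_setC cub optF) (order_bound_setC ordF).
by rewrite !lev_setC // addnC.
Qed.

Lemma lev012_lt F s : optimal F -> order_bound F s ->
  lev F 0 + lev F 1 + lev F 2 + 1 < 3 * s.
Proof.
move=> optF ordF; case: ltnP => // ?; exfalso; counts cub F.
have := lev0_le optF ordF; have := lev3_le optF ordF.
have := lev01_lt optF ordF; have := lev23_lt optF ordF => *.
case: ordF => ?; search cub optF
  [:: [:: add 2 1 2]; [:: add 1 2 2]; [:: add 1 1 2]; [:: add 0 1 2];
    [:: add 0 2 2]; [:: del 3 2 1]; [:: del 1 1 2]; [:: del 1 1 1]].
Qed.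

Lemma lev123_lt F s : optimal F -> order_bound F s ->
  lev F 1 + lev F 2 + lev F 3 + 1 < 3 * s.
Proof.
move=> optF ordF.
have := lev012_lt (optimal_setC cub optF) (order_bound_setC ordF).
rewrite !lev_setC // subn0 -[3 - 1]/2 -[3 - 2]/1; lia.
Qed.

(** The exceptional vector is excluded in [lev1_le_sharp], by two stars that share a degree class
    and so escape [double_cut]. *)
Lemma lev1_le F s : optimal F -> order_bound F s ->
  lev F 1 <= s \/
  [/\ lev F 0 + 2 = s, lev F 1 = s + 1, lev F 2 + 2 = s & lev F 3 + 1 = s].
Proof.
move=> optF ordF; case: leqP => [|?]; [by left|right].
have := lev0_le optF ordF; have := lev3_le optF ordF.
have := lev01_lt optF ordF; have := lev23_lt optF ordF.
have := lev012_lt optF ordF; have := lev123_lt optF ordF.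
move=> *; counts cub F.
suff: lev F 0 + 2 = s /\ lev F 1 = s + 1 /\ lev F 2 + 2 = s /\ lev F 3 + 1 = s.
  by case=> ? [? []].
case: ordF => ?; search cub optF
  [:: [:: add 1 1 2]; [:: del 1 1 1]; [:: add 1 1 1]; [:: add 0 2 1];
    [:: del 3 2 1]; [:: del 1 1 2]; [:: add 2 1 2; add 0 2 1];
    [:: add 1 2 1]].
Qed.

(** The exceptional vector is symmetric under complement; [balanced_exists] handles it by changing
    [F]. *)
Lemma lev12_lt F s : optimal F -> order_bound F s ->
    lev F 1 <= s -> lev F 2 <= s ->
  lev F 1 + lev F 2 < 2 * s \/
  [/\ lev F 0 + 2 = s, lev F 1 = s, lev F 2 = s & lev F 3 + 2 = s].
Proof.
move=> optF ordF ? ?; case: ltnP => [|?]; [by left|right].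
have := lev0_le optF ordF; have := lev3_le optF ordF.
have := lev01_lt optF ordF; have := lev23_lt optF ordF.
have := lev012_lt optF ordF; have := lev123_lt optF ordF.
move=> *; counts cub F.
suff: lev F 0 + 2 = s /\ lev F 1 = s /\ lev F 2 = s /\ lev F 3 + 2 = s.
  by case=> ? [? []].
case: ordF => ?; search cub optF
  [:: [:: add 1 1 2]; [:: del 1 1 2]; [:: add 2 1 2]; [:: del 1 1 1];
    [:: add 0 2 2]; [:: del 3 2 1]].
Qed.

End Bounds.

(** * Existence of a balanced edge set *)

(** A Hall condition: intervals of [s] weights for consecutive degrees overlap in one weight, so [r]
    consecutive classes have [r * s - (r - 1)] weights at their disposal. *)
Definition balanced (n : nat -> nat) s :=
  [/\ [/\ n 0 <= s, n 1 <= s, n 2 <= s & n 3 <= s],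
      [/\ n 0 + n 1 < 2 * s, n 1 + n 2 < 2 * s & n 2 + n 3 < 2 * s],
      n 0 + n 1 + n 2 + 1 < 3 * s, n 1 + n 2 + n 3 + 1 < 3 * s &
      n 0 + n 1 + n 2 + n 3 + 2 < 4 * s].

(* The exceptional vector of lev1_le has more vertices of degree 1 than of degree
   2, so some vertex of degree 2 can drop two edges to vertices of degree 1;
   adding one further edge between degrees 0 and 1 then lowers the energy. *)
Lemma lev1_le_sharp (G : sgraph) (F : {set {set G}}) s :
  cubic G -> optimal F -> order_bound F s -> lev F 1 <= s.
Proof.
move=> cub optF ordF; case: (lev1_le cub optF ordF) => // -[n0E n1E n2E n3E].
(* At each vertex of degree 1, both edges outside [F] lead to degree 0 and the edge in [F] leads to
   degree 2. *)
have g01 : joint F false 1 0 = 2 * lev F 1 /\ lev F 1 = joint F true 2 1.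
  counts cub F.
  search cub optF
    [:: [:: del 1 1 1]; [:: del 1 1 3]; [:: add 1 1 1]; [:: add 1 1 2]].
have [g01E f12E] := g01.
(* The [2 * (s + 1)] edges from degree 1 must fit among the [3 * (s - 2)] edge ends at degree 0. *)
have s8 : 8 <= s by counts cub F; rewrite joint_sym in g01E; lia.
have [w [L wL]] : exists w L, star_at F (del 2 2 1) w L.
  by apply: (star_exists cub); rewrite /= -f12E; lia.
have [uL /= /esym [w2 L1]] := wL.
have szL : size L = 2 by rewrite -(size_map (deg F)) -L1.
(* Class 1 occurs in both stars, so the new centre must avoid [L], whose two vertices account for at
   most 6 pairs. *)
have [w' [L' [w'L wL']]] :
    exists w' L', w' \notin [set x in L] /\ star_at F (add 1 1 0) w' L'.
  apply: crowded_star; rewrite // g01E mul0n add0n.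
  apply: (@leq_ltn_trans (3 * 2)); last by lia.
  by rewrite leq_mul2l cardsE -szL card_size.
have mv : moves F (before (del 2 2 1) ++ before (add 1 1 0))
    (after (del 2 2 1) ++ after (add 1 1 0)).
  apply: (moves_star2 wL wL').
  rewrite cat_uniq (star_at_uniq wL) (star_at_uniq wL') andbT.
  apply/hasPn => x; have [_ /= [w'1 L'0]] := wL'.
  rewrite !inE => /orP[/eqP->|xL'].
    rewrite inE in w'L; rewrite negb_or w'L andbT.
    by apply/eqP => w'w; move: w'1; rewrite w'w -w2.
  apply/negP => xL; have := star_at_before wL (x := x).
  rewrite inE xL => /(_ isT).
  have : deg F x \in [:: 0] by rewrite -L'0; apply: map_f.
  by rewrite inE => /eqP ->.
have := optimal_no_gain optF mv; rewrite /no_gain /mult /=; lia.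
Qed.

Lemma balanced_exists (G : sgraph) s : cubic G ->
    #|G| + 3 <= 4 * s <= #|G| + 6 ->
  exists F : {set {set G}}, balanced (lev F) s.
Proof.
move=> cub Gs; have [F optF] := optimal_exists G.
have tot := lev_total cub F; have evG := even_order cub.
have ordF : order_bound F s by rewrite /order_bound; lia.
have n0 := lev0_le cub optF ordF; have n3 := lev3_le cub optF ordF.
have n1 := lev1_le_sharp cub optF ordF.
have n2 : lev F 2 <= s.
  have := lev1_le_sharp cub (optimal_setC cub optF) (order_bound_setC cub ordF).
  by rewrite lev_setC.
have n01 := lev01_lt cub optF ordF; have n23 := lev23_lt cub optF ordF.
have n012 := lev012_lt cub optF ordF; have n123 := lev123_lt cub optF ordF.
case: (lev12_lt cub optF ordF n1 n2) => [n12|[n0E n1E n2E n3E]].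
  by exists F; do ![split => //]; lia.
(* In this case [F] itself is not balanced, but flipping an edge inside the degree
   class 1 or 2 balances it, at the same energy. *)
have [f11|f11] := boolP (crowded F (del 1 1 1)).
  have [F' H] := crowded_moves cub f11; exists F'.
  move: (H 0) (H 1) (H 2) (H 3); rewrite /mult /= => ? ? ? ?.
  by do ![split]; lia.
have [g22|g22] := boolP (crowded F (add 2 1 2)).
  have [F' H] := crowded_moves cub g22; exists F'.
  move: (H 0) (H 1) (H 2) (H 3); rewrite /mult /= => ? ? ? ?.
  by do ![split]; lia.
exfalso; move: f11 g22 => /= f11 g22; counts cub F.
search cub optF [:: [:: add 1 1 2]; [:: del 1 1 2]; [:: add 0 2 2; del 1 1 3]].
Qed.

(** * Weights and the labeling built from [F] *)

Section Labelings.
Variable G : sgraph.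
Hypothesis cub : cubic G.

(** Sending [u] to [[set v; u]] is a bijection from the neighbours of [v] to its edges. *)
Lemma sum_edges_at (f : {set G} -> nat) v :
  \sum_(e : edge G | v \in val e) f (val e) =
  \sum_(u in [set u | adj v u]) f [set v; u].
Proof.
rewrite -(big_sub_cond (edges G) (fun e => v \in e) f).
rewrite -(big_imset f (h := fun u => [set v; u])) /=.
  apply: eq_bigl => e; apply/andP/imsetP => [[]|[u]].
    case/imsetP => -[x y]; rewrite inE /= => xy ->; rewrite !inE => /orP[]/eqP->.
      by exists y; rewrite ?inE.
    by exists x; rewrite 1?setUC // inE adj_sym.
  rewrite inE => vu ->; rewrite !inE eqxx; split=> //.
  by apply/imsetP; exists (v, u); rewrite ?inE.
move=> x y; rewrite !inE => vx _ /setP/(_ x); rewrite !inE eqxx orbT.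
by case/esym/orP => /eqP // xv; rewrite xv adj_irrefl in vx.
Qed.

(** The weights are distinct and lie between 4 and [4 * k]. *)
Lemma irregular_card k (lam : G + edge G -> nat) : 0 < k ->
  total_labeling k lam -> vertex_irregular lam -> #|G| + 3 <= 4 * k.
Proof.
move=> k0 lamk irr.
have bound v : 4 <= weight lam v <= 4 * k.
  (* Extends [lam] to all vertex sets; the default 1 keeps the bounds valid everywhere. *)
  pose f (e : {set G}) := if insub e is Some e' then lam (inr e') else 1.
  have fk e : 1 <= f e <= k by rewrite /f; case: insub => // [_]; exact: lamk.
  have -> : weight lam v =
      lam (inl v) + \sum_(u in [set u | adj v u]) f [set v; u].
    rewrite -sum_edges_at; congr addn; apply: eq_bigr => e _.
    by rewrite /f valK.
  have lo : \sum_(u in [set u | adj v u]) 1 <=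
      \sum_(u in [set u | adj v u]) f [set v; u].
    by apply: leq_sum => u _; case/andP: (fk [set v; u]).
  have hi : \sum_(u in [set u | adj v u]) f [set v; u] <=
      \sum_(u in [set u | adj v u]) k.
    by apply: leq_sum => u _; case/andP: (fk [set v; u]).
  by move: lo hi (lamk (inl v)); rewrite !sum_nat_const cub; lia.
have inj : injective (weight lam).
  by move=> u v uv; apply/eqP; apply: contraPT uv => /eqP; apply: irr.
have : size (map (weight lam) (enum G)) <= size (iota 4 (4 * k - 3)).
  apply: uniq_leq_size; first by rewrite map_inj_uniq ?enum_uniq.
  by move=> w /mapP[v _ ->]; rewrite mem_iota; have := bound v; lia.
rewrite size_map -cardE size_iota => le.
(* [0 < k] makes the subtraction in [4 * k - 3] exact. *)
by apply: leq_trans (leq_add le (leqnn 3)) _; lia.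
Qed.

(* Vertices of degree [d] in [F] receive the weights [start d + 4],
   [start d + 5], ...; with edge labels [1] and [t.+1] they can realise exactly
   the weights from [d * t + 4] to [d * t + t + 4]. *)
Fixpoint start (n : nat -> nat) t d :=
  if d is d'.+1 then maxn (d * t) (start n t d' + n d') else 0.

(** Unfolding the maxima, each upper bound is a [balanced] inequality for a run of classes ending at
    [d]. *)
Lemma startP n t d : balanced n t.+1 -> d <= 3 ->
  d * t <= start n t d /\ start n t d + n d <= d.+1 * t + 1.
Proof.
by case=> -[? ? ? ?] [? ? ?] ? ? ?; case: d => [|[|[|[|]]]] //= _; lia.
Qed.

Lemma start_mono n t d d' : d < d' -> start n t d + n d <= start n t d'.
Proof.
elim: d' => // d' IH; rewrite ltnS leq_eqVlt => /predU1P[->|/IH dd'] /=.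
  exact: leq_maxr.
by apply: leq_trans (leq_maxr _ _); apply: leq_trans dd' (leq_addr _ _).
Qed.

Variables (F : {set {set G}}) (t : nat).
Hypothesis balF : balanced (lev F) t.+1.

Definition slot v := index v (enum [set u | deg F u == deg F v]).

(** The incident edges contribute [3 + deg F v * t]; the vertex label supplies the rest of the
    intended weight. *)
Definition labeling (x : G + edge G) :=
  match x with
  | inl v => (start (lev F) t (deg F v) + slot v - deg F v * t).+1
  | inr e => if val e \in F then t.+1 else 1
  end.

Lemma slot_lt v : slot v < lev F (deg F v).
Proof. by rewrite /lev cardE index_mem mem_enum inE. Qed.

Lemma weight_labeling v :
  weight labeling v = start (lev F) t (deg F v) + slot v + 4.
Proof.
rewrite /weight (sum_edges_at (fun e => if e \in F then t.+1 else 1)) /=.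
have -> : \sum_(u in [set u | adj v u]) (if [set v; u] \in F then t.+1 else 1)
    = 3 + deg F v * t.
  rewrite -(cub v) -sum1_card /deg -sum_nat_const.
  have -> : \sum_(u in [set u | link F true v u]) t =
      \sum_(u in [set u | adj v u]) (if [set v; u] \in F then t else 0).
    by rewrite -big_mkcondr; apply: eq_bigl => u; rewrite !inE /link eqb_id.
  by rewrite -big_split; apply: eq_bigr => u _; case: ifP.
have [] := startP balF (deg_le3 cub F v); lia.
Qed.

Lemma labeling_total : total_labeling t.+1 labeling.
Proof.
case=> [v|e] /=; last by case: ifP => _; lia.
have [] := startP balF (deg_le3 cub F v); have := slot_lt v; lia.
Qed.

(** Blocks of different degrees are disjoint by [start_mono], so equal weights force equal degrees,
    then equal slots. *)
Lemma labeling_irregular : vertex_irregular labeling.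
Proof.
move=> u v uv; rewrite !weight_labeling => /addIn E; apply: uv.
have lt x y : start (lev F) t (deg F x) + slot x =
    start (lev F) t (deg F y) + slot y -> deg F y <= deg F x.
  move=> xy; rewrite leqNgt; apply/negP => /(start_mono (lev F) t).
  by have := slot_lt x; lia.
have duv : deg F u = deg F v by apply/eqP; rewrite eqn_leq !lt.
have := E; rewrite /slot duv => /addnI.
move/(congr1 (nth u (enum [set x | deg F x == deg F v]))).
by rewrite !nth_index // mem_enum inE ?duv.
Qed.

End Labelings.

(** * Value of the strength *)

Lemma ceil_quarter (n s : nat) :
  Posz s = Num.ceil ((n + 3)%N%:R / 4%:R : rat)%R -> n + 3 <= 4 * s <= n + 6.
Proof.
move=> sE; have := Num.Theory.ceil_itv ((n + 3)%N%:R / 4%:R : rat)%R.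
rewrite -sE Num.Theory.ltr_pdivlMr // Num.Theory.ler_pdivrMr //.
(* Both sides are images of integers, so the comparison descends from [rat] to [int]. *)
rewrite -[(n + 3)%:R%R]/((Posz (n + 3))%:~R)%R -[4%:R%R]/((Posz 4)%:~R)%R.
rewrite -!GRing.rmorphM.
rewrite ltr_int ler_int => /andP[lt le].
have {}lt : ((Posz s - 1) * 4 < Posz (n + 3))%R := lt.
have {}le : (Posz (n + 3) <= Posz s * 4)%R := le.
clear sE; lia.
Qed.

Theorem theorem1p2 (G : sgraph) (n s : nat)
    (hG : cubic G) (hn : #|G| = n)
    (hs : Posz s = Num.ceil ((n + 3)%N%:R / 4%:R : rat)%R) :
  tvs G = s /\
  exists lam : G + edge G -> nat,
    [/\ total_labeling s lam,
        vertex_irregular lam &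
        forall e : edge G, lam (inr e) = 1 \/ lam (inr e) = s].
Proof.
have ns := ceil_quarter hs.
have [t st] : exists t, s = t.+1 by exists s.-1; lia.
have [F balF] : exists F : {set {set G}}, balanced (lev F) s.
  by apply: balanced_exists; rewrite // hn.
rewrite st in balF *; split; last first.
  exists (labeling F t); split=> [||e] /=.
  - exact: labeling_total.
  - exact: labeling_irregular.
  - by case: ifP; [right|left].
rewrite /tvs; case: ex_minnP => k /andP[k0 /asboolP[lam [lamk irr]]] mink.
apply/eqP; rewrite eqn_leq mink /=.
  (* [4 * s <= n + 6] and [n + 3 <= 4 * k] give [s <= k]. *)
  by have := irregular_card hG k0 lamk irr; lia.
apply/asboolP; exists (labeling F t); split; first exact: labeling_total.
exact: labeling_irregular.
Qed.
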